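(* Let $G_1,G_2$ be finite groups with $|G_1|=|G_2|$, and let $H_1\subsetneq G_1$, $H_2\subsetneq G_2$ be nontrivial proper subgroups with $|H_1|=|H_2|$. Let $d_1,d_2$ be metrics on $H_1,H_2$ respectively that are invariant under right translations ($d_i(xh,yh)=d_i(x,y)$ for $x,y,h\in H_i$), and let $\tau:(H_1,d_1)\to(H_2,d_2)$ be an isometry. Then there exist metrics $\tilde d_1$ on $G_1$ and $\tilde d_2$ on $G_2$ whose restrictions to $H_1$ and $H_2$ are $d_1$ and $d_2$, and an isometry $\eta:(G_1,\tilde d_1)\to(G_2,\tilde d_2)$ with $\eta|_{H_1}=\tau$.
   Context: An isometry between metric spaces is a bijection preserving distances. *)

(* Defs.v *)
From mathcomp Require Import all_boot all_order all_algebra all_fingroup.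
From mathcomp Require Import reals.

Set Implicit Arguments.
Unset Strict Implicit.
Unset Printing Implicit Defensive.

Import GRing.Theory Num.Theory.
Local Open Scope ring_scope.

(* A metric on a subset A of T is represented by a function on the whole of T,
   of which only the values on A * A are meaningful. The library's metricType
   attaches one fixed metric to a whole type, whereas metrics on subgroups, and
   on all of a group, have to be quantified over here. *)
Definition metric_on (R : realType) (T : finType) (A : {set T})
    (d : T -> T -> R) : Prop :=
  [/\ {in A &, forall x y, 0 <= d x y},
      {in A &, forall x y, d x y = 0 <-> x = y},
      {in A &, forall x y, d x y = d y x}
    & {in A & &, forall x y z, d x z <= d x y + d y z}].

Definition right_invariant_on (R : realType) (gT : finGroupType)
    (H : {set gT}) (d : gT -> gT -> R) : Prop :=
  {in H & &, forall x y h, d (x * h)%g (y * h)%g = d x y}.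

(* Bijectivity from A1 to A2 is injectivity on A1 together with image A2. *)
Definition isometry_on (R : realType) (T1 T2 : finType)
    (A1 : {set T1}) (d1 : T1 -> T1 -> R) (A2 : {set T2}) (d2 : T2 -> T2 -> R)
    (f : T1 -> T2) : Prop :=
  [/\ {in A1 &, injective f}, f @: A1 = A2
    & {in A1 &, forall x y, d2 (f x) (f y) = d1 x y}].

(* Main.v *)
(** Choose [M > 0] at least as large as all values of [d1], hence of [d2]. Giving
    distance [M] to any two distinct points not both in the subgroup extends
    each metric to the whole group; any extension of [tau] by a bijection
    between the complements of the subgroups is then an isometry. *)
Require Import Defs.
From mathcomp Require Import all_boot all_order all_algebra all_fingroup.
From mathcomp Require Import reals.
From mathcomp Require Import lra.

Set Implicit Arguments.
Unset Strict Implicit.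
Unset Printing Implicit Defensive.

Import Order.TTheory GRing.Theory Num.Theory.
Local Open Scope ring_scope.

(** The test [x == y] comes first because a point outside [A] would otherwise lie at distance [M]
    from itself. *)
Definition extend_dist (R : realType) (T : finType) (A : {set T})
    (d : T -> T -> R) (M : R) (x y : T) : R :=
  if x == y then 0 else if (x \in A) && (y \in A) then d x y else M.

Lemma extend_distE (R : realType) (T : finType) (A : {set T})
    (d : T -> T -> R) (M : R) :
  metric_on A d -> {in A &, extend_dist A d M =2 d}.
Proof.
case=> _ d0 _ _ x y xA yA; rewrite /extend_dist xA yA /=.
by case: eqP => // xy; apply/esym/d0.
Qed.

(** The triangle inequality survives because, in a triangle with distinct vertices not all in [A],
    the two sides at a vertex outside [A] equal [M] and the third is at most [M]. *)
Lemma extend_dist_metric (R : realType) (T : finType) (A B : {set T})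
    (d : T -> T -> R) (M : R) :
  metric_on A d -> 0 < M -> {in A &, forall x y, d x y <= M} ->
  metric_on B (extend_dist A d M).
Proof.
case=> d_ge0 d_eq0 d_sym d_tri M_gt0 leM.
have ge0 x y : 0 <= extend_dist A d M x y.
  rewrite /extend_dist; case: ifP => // _; case: ifP => [/andP[xA yA]|_].
    exact: d_ge0.
  exact: ltW.
split=> [x y _ _ | x y _ _ | x y _ _ | x y z _ _ _].
- exact: ge0.
- rewrite /extend_dist; case: eqP => // xy; split=> //.
  case: ifP => [/andP[xA yA] /d_eq0|_ M0]; first exact.
  by rewrite M0 ltxx in M_gt0.
- rewrite /extend_dist eq_sym andbC; case: ifP => // _.
  by case: ifP => // /andP[yA xA]; apply: d_sym.
have [->|yx] := eqVneq y x.
  by rewrite -[leLHS]add0r lerD2r ge0.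
have [->|yz] := eqVneq y z.
  by rewrite -[leLHS]addr0 lerD2l ge0.
move: (ge0 x y) (ge0 y z).
rewrite /extend_dist (eq_sym x y) (negPf yx) (negPf yz).
have [_|xz] := eqVneq x z; first by move=> *; apply: addr_ge0.
(* If [x] or [z] is outside [A], the left side and a summand on the right are both [M], so
   nonnegativity of the other summand suffices. Two cases remain: all three points in [A], or only
   [y] outside. *)
case xA: (x \in A); case yA: (y \in A); case zA: (z \in A) => //=; try lra.
- by move=> _ _; apply: d_tri.
- by move: (leM x z xA zA); lra.
Qed.

Lemma dist_bounded (R : realType) (T : finType) (A : {set T})
    (d : T -> T -> R) :
  metric_on A d -> exists2 M, 0 < M & {in A &, forall x y, d x y <= M}.
Proof.
case=> d_ge0 _ _ _.
have sum_ge0 (P : pred T) x : x \in A -> 0 <= \sum_(y in A | P y) d x y.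
  by move=> xA; apply: sumr_ge0 => y /andP[yA _]; apply: d_ge0.
have row_ge0 x : x \in A -> 0 <= \sum_(y in A) d x y.
  by move=> xA; apply: sumr_ge0 => y yA; apply: d_ge0.
(* A sum of nonnegative distances dominates each of its terms; the [1] keeps the bound positive even
   when all distances vanish. *)
exists (1 + \sum_(x in A) \sum_(y in A) d x y).
  by apply: ltr_pwDl => //; apply: sumr_ge0.
move=> x y xA yA; rewrite (bigD1 x) //= (bigD1 y) //=.
have := sum_ge0 (predC1 y) x xA.
have : 0 <= \sum_(i in A | i != x) \sum_(j in A) d i j.
  by apply: sumr_ge0 => i /andP[iA _]; apply: row_ge0.
by rewrite /=; lra.
Qed.

(** The complements [B1 :\: A1] and [B2 :\: A2] have the same size, so their enumerations can be
    matched index by index. *)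
Lemma extend_bijection (T1 T2 : finType) (A1 B1 : {set T1}) (A2 B2 : {set T2})
    (f : T1 -> T2) :
  A1 \subset B1 -> A2 \subset B2 -> #|B1| = #|B2| ->
  {in A1 &, injective f} -> f @: A1 = A2 ->
  exists g : T1 -> T2,
    [/\ {in B1 &, injective g}, g @: B1 = B2, {in A1, g =1 f}
      & {in B1, forall x, (g x \in A2) = (x \in A1)}].
Proof.
move=> sA1 sA2 cardB f_inj fA1.
set s1 := enum (B1 :\: A1); set s2 := enum (B2 :\: A2).
have sz : size s1 = size s2.
  rewrite -!cardE !cardsD (setIidPr sA1) (setIidPr sA2) cardB -fA1.
  by rewrite card_in_imset.
(* The default [f x] is never reached for [x] in [B1]; it merely supplies an element of [T2], which
   could be empty a priori. *)
pose g x := if x \in A1 then f x else nth (f x) s2 (index x s1).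
have gA x : x \in A1 -> g x = f x by rewrite /g => ->.
have s1P x : x \in B1 -> x \notin A1 -> x \in s1.
  by move=> xB xA; rewrite mem_enum inE xA.
have lt_idx x : x \in B1 -> x \notin A1 -> (index x s1 < size s2)%N.
  by move=> xB xA; rewrite -sz index_mem s1P.
have gD x : x \in B1 -> x \notin A1 -> g x \in B2 :\: A2.
  move=> xB xA; rewrite -mem_enum /g (negPf xA).
  by rewrite mem_nth // lt_idx.
have fA x : x \in A1 -> f x \in A2 by move=> xA; rewrite -fA1 imset_f.
have gE : {in B1, forall x, (g x \in A2) = (x \in A1)}.
  move=> x xB; case: (boolP (x \in A1)) => xA; first by rewrite gA // fA.
  by have := gD x xB xA; rewrite inE => /andP[/negPf].
have g_inj : {in B1 &, injective g}.
  move=> x y xB yB gxy.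
  have xyA : (x \in A1) = (y \in A1) by rewrite -!gE // gxy.
  case: (boolP (x \in A1)) (xyA) => xA /esym yA.
    by apply: f_inj => //; rewrite -!gA.
  have yA' : y \notin A1 by rewrite yA.
  move: gxy; rewrite /g (negPf xA) yA.
  (* The two [nth] terms carry different defaults, which must be aligned before uniqueness of [s2]
     can equate the indices. *)
  rewrite (set_nth_default (f x) (f y)) ?lt_idx // => /eqP.
  rewrite nth_uniq ?enum_uniq ?lt_idx // => /eqP.
  exact: (index_inj x (s1P x xB xA) (s1P y yB yA')).
exists g; split=> //.
apply/eqP; rewrite eqEcard card_in_imset // cardB leqnn andbT.
(* By injectivity and equal cardinalities, only the inclusion of the image in [B2] is left. *)
apply/subsetP => _ /imsetP[x xB ->].
case: (boolP (x \in A1)) => xA; first by rewrite gA // (subsetP sA2) ?fA.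
by have := gD x xB xA; rewrite inE => /andP[].
Qed.

Theorem theorem6p1 (R : realType) (gT1 gT2 : finGroupType)
    (G1 H1 : {group gT1}) (G2 H2 : {group gT2})
    (cardG : #|G1| = #|G2|)
    (properH1 : H1 \proper G1) (properH2 : H2 \proper G2)
    (ntH1 : H1 :!=: 1%g) (ntH2 : H2 :!=: 1%g)
    (cardH : #|H1| = #|H2|)
    (d1 : gT1 -> gT1 -> R) (d2 : gT2 -> gT2 -> R)
    (metric_d1 : metric_on H1 d1) (metric_d2 : metric_on H2 d2)
    (inv_d1 : right_invariant_on H1 d1) (inv_d2 : right_invariant_on H2 d2)
    (tau : gT1 -> gT2) (isom_tau : isometry_on H1 d1 H2 d2 tau) :
  exists (dt1 : gT1 -> gT1 -> R) (dt2 : gT2 -> gT2 -> R),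
    [/\ metric_on G1 dt1, metric_on G2 dt2,
        {in H1 &, dt1 =2 d1}, {in H2 &, dt2 =2 d2}
      & exists eta : gT1 -> gT2,
          isometry_on G1 dt1 G2 dt2 eta /\ {in H1, eta =1 tau}].
Proof.
have [M M_gt0 leM1] := dist_bounded metric_d1.
have [tau_inj tauH tau_d] := isom_tau.
have leM2 : {in H2 &, forall x y, d2 x y <= M}.
  rewrite -tauH => _ _ /imsetP[x xH ->] /imsetP[y yH ->].
  by rewrite tau_d // leM1.
exists (extend_dist H1 d1 M), (extend_dist H2 d2 M); split.
- exact: extend_dist_metric.
- exact: extend_dist_metric.
- exact: extend_distE.
- exact: extend_distE.
have [eta [eta_inj etaG eta_tau etaH]] :=
  extend_bijection (proper_sub properH1) (proper_sub properH2) cardG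
                   tau_inj tauH.
exists eta; split=> //; split=> // x y xG yG.
(* Injectivity of [eta] and [etaH] make both distances fall into the same case of [extend_dist];
   only pairs of distinct points of [H1] then need [tau_d]. *)
rewrite /extend_dist (inj_in_eq eta_inj) // !etaH //.
case: ifP => // _; case: ifP => // /andP[xH yH].
by rewrite !eta_tau // tau_d.
Qed.
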